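(* Let $\omega:[0,1]\to[0,1]$ be a continuous function, let $[a,b]\subseteq[0,1]$ and let $0<c<1$. Then the cone $$\mathcal K_{\omega}=\left\{ w\in C_{\omega}^{1}[0,1]: w\ge 0,\ \min_{t\in[a,b]}w(t)\ge c\,\|w\|_{\infty},\ \|w\|_{\infty}\ge \|w'\|_{\omega}\right\}$$ is total in $C^1_\omega[0,1]$, i.e. $C^1_{\omega}[0,1]=\overline{\mathcal K_{\omega}-\mathcal K_{\omega}}$, where the closure is taken in the norm of $C^1_\omega[0,1]$.
   Context: $C_{\omega}^1[0,1]$ is the space of all real functions $w\in C[0,1]$ that are continuously differentiable on $]0,1[$ and satisfy $\sup_{t\in]0,1[}\omega(t)|w'(t)|<+\infty$. Put $\|w\|_\infty=\max_{t\in[0,1]}|w(t)|$ and $\|w'\|_\omega=\sup_{t\in]0,1[}\omega(t)|w'(t)|$. The norm on $C^1_\omega[0,1]$ is $\|w\|=\max\{\|w\|_\infty,\|w'\|_\omega\}$. For a set $K$ in a vector space, $K-K=\{x-y:x,y\in K\}$. *)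

(* Defs.v *)
From HB Require Import structures.
From mathcomp Require Import all_boot all_order all_algebra.
From mathcomp Require Import all_classical all_reals all_analysis.

Set Implicit Arguments.
Unset Strict Implicit.
Unset Printing Implicit Defensive.

Import Order.TTheory GRing.Theory Num.Theory.
Import numFieldNormedType.Exports.

Local Open Scope classical_set_scope.
Local Open Scope ring_scope.

Record weight (R : realType) := Weight {
  weight_fun :> R -> R;
  weight_continuous : {within `[0, 1], continuous weight_fun};
  weight_itv : forall t : R, t \in `[0, 1] -> weight_fun t \in `[0, 1] }.

(* For [w] continuous on the interval these [sup] and [inf] are attained, i.e.
   they are a maximum and a minimum: see [max_normP] and [minIP]. *)
Definition max_norm (R : realType) (w : R -> R) : R :=
  sup [set `|w t| | t in `[0, 1]].

Definition minI (R : realType) (a b : R) (w : R -> R) : R :=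
  inf [set w t | t in `[a, b]].

Definition weighted_norm (R : realType) (omega w : R -> R) : R :=
  sup [set omega t * `|w t| | t in `]0, 1[].

(* A function on [0, 1] is represented by its extension by 0 to the whole line,
   so that equality of representatives is equality of functions on [0, 1]. *)
Definition is_C1w (R : realType) (omega : weight R) : set (R -> R) :=
  [set w : R -> R |
    [/\ forall t : R, t \notin `[0, 1] -> w t = 0,
        {within `[0, 1], continuous w},
        forall t : R, t \in `]0, 1[ -> derivable w t 1,
        {in `]0, 1[, continuous (derive1 w)} &
        has_ubound [set omega t * `|derive1 w t| | t in `]0, 1[]]].

Definition C1w_pred (R : realType) (omega : weight R) : {pred R -> R} :=
  mem (is_C1w omega).

Section C1w.
Context (R : realType) (omega : weight R).

Record C1w := MkC1w { C1w_fun :> R -> R; C1wP : C1w_fun \in C1w_pred omega }.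

HB.instance Definition _ := [isSub for C1w_fun].
HB.instance Definition _ := [Choice of C1w by <:].

Let oo_cc (t : R) : t \in `]0, 1[ -> t \in `[0, 1].
Proof. by rewrite !in_itv/= => /andP[/ltW -> /ltW ->]. Qed.

Let half_oo : (2^-1 : R) \in `]0, 1[.
Proof. by rewrite in_itv/= invr_gt0 ltr0n invf_lt1// ltr1n. Qed.

Let omega_ge0 t : t \in `]0, 1[ -> 0 <= omega t.
Proof. by move=> /oo_cc /(weight_itv omega); rewrite in_itv/= => /andP[]. Qed.

Lemma derive1_linear (k t : R) (u v : R -> R) :
  derivable u t 1 -> derivable v t 1 ->
  derive1 (k *: u + v) t = k * derive1 u t + derive1 v t.
Proof.
move=> du dv; rewrite !derive1E deriveD//; last exact: derivableZ.
by rewrite deriveZ.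
Qed.

Lemma C1w_submod_closed : submod_closed (C1w_pred omega).
Proof.
split=> [|k u v].
  rewrite inE; split => [//|||t _|].
  - by apply: continuous_subspaceT => t; exact: cvg_cst.
  - by move=> t _; exact: derivable_cst.
  - have -> : derive1 (0 : R -> R) = cst 0.
      by apply/funext => s; exact: derive1_cst.
    exact: cvg_cst.
  - exists 0 => _ [t _ <-].
    by rewrite (derive1_cst (0 : R) t) normr0 mulr0.
rewrite !inE => -[u0 cu du cdu [M uM]] [v0 cv dv cdv [N vN]].
have dE t : t \in `]0, 1[ ->
    derive1 (k *: u + v) t = k * derive1 u t + derive1 v t.
  by move=> t01; apply: derive1_linear; [exact: du|exact: dv].
split.
- by move=> t t01; rewrite -[LHS]/(k * u t + v t) u0// v0// mulr0 addr0.
- move=> t; apply: cvgD; last exact: cv.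
  by apply: cvgZr; exact: cu.
- by move=> t t01; apply: derivableD; [apply: derivableZ; exact: du|exact: dv].
- move=> t t01.
  rewrite /continuous_at dE//.
  have c1 : k * derive1 u s @[s --> t] --> k * derive1 u t.
    by apply: cvgMl_tmp; exact: cdu.
  apply: cvg_trans (cvgD c1 (cdv _ t01)).
  apply: near_eq_cvg; near=> s; rewrite dE//.
  by near: s; exact: near_in_itvoo.
- exists (`|k| * M + N) => _ [t t01 <-].
  rewrite dE//.
  have uMt : omega t * `|derive1 u t| <= M by apply: uM; exists t.
  have vNt : omega t * `|derive1 v t| <= N by apply: vN; exists t.
  rewrite (le_trans (ler_wpM2l (omega_ge0 t01) (ler_normD _ _)))//.
  by rewrite mulrDr normrM mulrCA lerD// ler_wpM2l.
Unshelve. all: by end_near. Qed.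

HB.instance Definition _ :=
  GRing.isSubmodClosed.Build R (R -> R) (C1w_pred omega) C1w_submod_closed.
HB.instance Definition _ := [SubChoice_isSubLmodule of C1w by <:].

Lemma C1w_is_C1w (w : C1w) : is_C1w omega w.
Proof. exact: set_mem (C1wP w). Qed.

Definition C1w_norm (w : C1w) : R :=
  Num.max (max_norm w) (weighted_norm omega (derive1 w)).

Let cc0 : (0 : R) \in `[0, 1].
Proof. by rewrite in_itv/= lexx ler01. Qed.

Lemma max_normP (w : R -> R) : {within `[0, 1], continuous w} ->
  exists2 t, t \in `[0, 1] &
    max_norm w = `|w t| /\ {in `[0, 1], forall s, `|w s| <= `|w t|}.
Proof.
move=> cw.
have [t t01 wt] := EVT_max (@ler01 R) (fun s => cvg_norm (cw s)).
exists t => //; split => //; apply/eqP; rewrite eq_le; apply/andP; split.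
  apply: ge_sup; first by exists `|w t|, t.
  by move=> _ [s s01 <-]; exact: wt.
apply: ub_le_sup; last by exists t.
by exists `|w t| => _ [s s01 <-]; exact: wt.
Qed.

Lemma minIP (a b : R) (w : R -> R) : a <= b -> {within `[a, b], continuous w} ->
  exists2 t, t \in `[a, b] &
    minI a b w = w t /\ {in `[a, b], forall s, w t <= w s}.
Proof.
move=> ab cw; have [t tab wt] := EVT_min ab cw.
exists t => //; split => //; apply/eqP; rewrite eq_le; apply/andP; split.
  apply: ge_inf; last by exists t.
  by exists (w t) => _ [s sab <-]; exact: wt.
apply: lb_le_inf; first by exists (w t), t.
by move=> _ [s sab <-]; exact: wt.
Qed.

Lemma max_norm_ge (w : C1w) t : t \in `[0, 1] -> `|w t| <= max_norm w.
Proof.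
have [_ cw _ _ _] := C1w_is_C1w w.
by move=> t01; have [s _ [-> ]] := max_normP cw; apply.
Qed.

Lemma weighted_norm_ge (w : C1w) t : t \in `]0, 1[ ->
  omega t * `|derive1 w t| <= weighted_norm omega (derive1 w).
Proof.
have [_ _ _ _ bw] := C1w_is_C1w w.
by move=> t01; apply: ub_le_sup => //; exists t.
Qed.

Lemma max_norm_le (w : R -> R) M :
  (forall t, t \in `[0, 1] -> `|w t| <= M) -> max_norm w <= M.
Proof.
move=> wM; apply: ge_sup; first by exists `|w 0|, 0.
by move=> _ [t t01 <-]; exact: wM.
Qed.

Lemma weighted_norm_le (w : R -> R) M :
  (forall t, t \in `]0, 1[ -> omega t * `|w t| <= M) ->
  weighted_norm omega w <= M.
Proof.
move=> wM; apply: ge_sup.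
  by exists (omega 2^-1 * `|w 2^-1|), 2^-1.
by move=> _ [t t01 <-]; exact: wM.
Qed.

Lemma C1w_norm_le (w : C1w) M :
  (forall t, t \in `[0, 1] -> `|w t| <= M) ->
  (forall t, t \in `]0, 1[ -> omega t * `|derive1 w t| <= M) ->
  C1w_norm w <= M.
Proof.
by move=> h1 h2; rewrite ge_max max_norm_le// weighted_norm_le.
Qed.

Lemma C1w_norm_ge (w : C1w) t : t \in `[0, 1] -> `|w t| <= C1w_norm w.
Proof. by move=> t01; rewrite le_max max_norm_ge. Qed.

Lemma C1w_norm_ge' (w : C1w) t : t \in `]0, 1[ ->
  omega t * `|derive1 w t| <= C1w_norm w.
Proof. by move=> t01; rewrite le_max weighted_norm_ge// orbT. Qed.

Lemma C1w_derivable (w : C1w) t : t \in `]0, 1[ -> derivable w t 1.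
Proof. by have [_ _ dw _ _] := C1w_is_C1w w; exact: dw. Qed.

Lemma C1w_norm_ge0 (w : C1w) : 0 <= C1w_norm w.
Proof. exact: le_trans (C1w_norm_ge w cc0). Qed.

Let C1w_normD (u v : C1w) : C1w_norm (u + v) <= C1w_norm u + C1w_norm v.
Proof.
apply: C1w_norm_le => t t01.
  by rewrite (le_trans (ler_normD _ _))// lerD// C1w_norm_ge.
have -> : derive1 (u + v : C1w) t = derive1 u t + derive1 v t.
  by rewrite derive1E deriveD ?derive1E//; exact: C1w_derivable.
rewrite (le_trans (ler_wpM2l (omega_ge0 t01) (ler_normD _ _)))//.
by rewrite mulrDr lerD// C1w_norm_ge'.
Qed.

Let C1w_normZ_le (k : R) (w : C1w) : C1w_norm (k *: w) <= `|k| * C1w_norm w.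
Proof.
apply: C1w_norm_le => t t01.
  by rewrite [leLHS]normrM ler_wpM2l// C1w_norm_ge.
have -> : derive1 (k *: w : C1w) t = k * derive1 w t.
  by rewrite derive1E deriveZ ?derive1E//; exact: C1w_derivable.
by rewrite normrM mulrCA ler_wpM2l// C1w_norm_ge'.
Qed.

Let C1w_normZ (k : R) (w : C1w) : C1w_norm (k *: w) = `|k| * C1w_norm w.
Proof.
apply/eqP; rewrite eq_le C1w_normZ_le/=.
have [->|k0] := eqVneq k 0; first by rewrite normr0 mul0r C1w_norm_ge0.
rewrite -ler_pdivlMl ?normr_gt0// -normfV.
by rewrite -[in leLHS](scalerK k0 w) C1w_normZ_le.
Qed.

Let C1w_norm0_eq0 (w : C1w) : C1w_norm w = 0 -> w = 0.
Proof.
move=> w0; apply: val_inj; apply/funext => t /=.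
have [t01|t01] := boolP (t \in `[0, 1]).
  by apply/eqP; rewrite -normr_le0 -w0 C1w_norm_ge.
by have [-> ] := C1w_is_C1w w.
Qed.

HB.instance Definition _ :=
  Lmodule_isNormed.Build R C1w C1w_normD C1w_normZ C1w_norm0_eq0.

Lemma C1w_normE (w : C1w) : `|w| = C1w_norm w.
Proof. by []. Qed.

Definition Kw (a b c : R) : set C1w :=
  [set w | [/\ forall t : R, t \in `[0, 1] -> 0 <= w t,
               c * max_norm w <= minI a b w &
               weighted_norm omega (derive1 w) <= max_norm w]].

End C1w.

Arguments Kw {R} omega a b c.

(* Main.v *)
Require Import Defs.
From mathcomp Require Import all_boot all_order all_algebra.
From mathcomp Require Import all_classical all_reals all_analysis.
From mathcomp Require Import lra.
Import Order.TTheory GRing.Theory Num.Theory.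
Import numFieldNormedType.Exports.
Local Open Scope classical_set_scope.
Local Open Scope ring_scope.

(* Already [K - K] is the whole space: [w = (w + l) - l], and for a constant
    [l >= 2 |w| / (1 - c)] the function [w + l] deviates from [l] so little,
    relatively to [l], that both [w + l] and [l] belong to the cone. *)

(** The unit constant in the encoding by zero extension: [cst 1] does not vanish off [0, 1], so it
    is no element of [C1w]. *)
Definition one01 {R : realType} (t : R) : R := (t \in `[0, 1])%:R.

Lemma one01E {R : realType} (t : R) : t \in `[0, 1] -> one01 t = 1.
Proof. by rewrite /one01 => ->. Qed.

Lemma one01_near {R : realType} (t : R) : t \in `]0, 1[ ->
  \near t, cst 1 t = one01 t.
Proof.
move=> t01; near=> s; rewrite one01E//=.
have : s \in `]0, 1[ by near: s; exact: near_in_itvoo.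
exact: subset_itv_oo_cc.
Unshelve. all: by end_near. Qed.

Lemma is_derive_one01 {R : realType} (t : R) : t \in `]0, 1[ ->
  is_derive t 1 one01 0.
Proof.
move=> t01; apply: (near_eq_is_derive (one01_near t t01)); exact: is_derive_cst.
Qed.

Lemma derive1_one01 {R : realType} (t : R) : t \in `]0, 1[ ->
  derive1 one01 t = 0.
Proof.
by move=> t01; rewrite derive1E; have [_ ->] := is_derive_one01 t t01.
Qed.

Lemma is_C1w_one01 {R : realType} (omega : weight R) : is_C1w omega one01.
Proof.
split.
- by move=> t; rewrite /one01 => /negbTE ->.
(* The jumps at 0 and 1 are invisible here: continuity within [0, 1] only looks at values on
   [0, 1]. *)
- apply: (@subspace_eq_continuous _ _ _ (cst 1 : R -> R)).
    by move=> t; rewrite inE => t01; rewrite /from_subspace/= one01E.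
  by apply: continuous_subspaceT => t; exact: cvg_cst.
- by move=> t /is_derive_one01[].
- move=> t t01; rewrite /continuous_at derive1_one01//.
  have c0 : cst (0 : R) s @[s --> t] --> (0 : R) by exact: cvg_cst.
  apply: cvg_trans c0; apply: near_eq_cvg; near=> s.
  rewrite derive1_one01//; near: s; exact: near_in_itvoo.
- exists 0 => _ [t t01 <-].
  by rewrite derive1_one01// normr0 mulr0.
Unshelve. all: by end_near. Qed.

Definition C1w_one {R : realType} (omega : weight R) : C1w omega :=
  MkC1w (mem_set (is_C1w_one01 omega)).

(** With N the norm of [w], the shifted function takes values between l - N and l + N on [0, 1], and
    its derivative is still that of [w]. The cone conditions thus reduce to c (l + N) <= l - N and N
    <= l - N. *)
Lemma Kw_shift {R : realType} (omega : weight R) (a b c l : R) (w : C1w omega) :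
  0 <= a -> a <= b -> b <= 1 -> 0 < c -> c < 1 ->
  2 * `|w| <= (1 - c) * l -> Kw omega a b c (l *: C1w_one omega + w).
Proof.
move=> a0 ab b1 c0 c1 wl; set N := `|w| in wl.
have N0 : 0 <= N by exact: normr_ge0.
(* As 0 < 1 - c < 1, the hypothesis forces l >= 0, hence (1 - c) l <= l. *)
have N2l : 2 * N <= l by nra.
have wE t : t \in `[0, 1] -> (l *: C1w_one omega + w) t = l + w t.
  by move=> t01; rewrite -[LHS]/(l * one01 t + w t) one01E// mulr1.
have wN t : t \in `[0, 1] -> - N <= w t <= N.
  by move=> t01; rewrite -ler_norml; exact: C1w_norm_ge.
have ab01 t : t \in `[a, b] -> t \in `[0, 1].
  by rewrite !in_itv/=; lra.
have [_ cu _ _ _] := C1w_is_C1w (l *: C1w_one omega + w).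
split.
- by move=> t t01; rewrite wE//; have /andP[] := wN t t01; lra.
- apply: (@le_trans _ _ (c * (l + N))).
    rewrite ler_pM2l//; apply: max_norm_le => t t01.
    by rewrite wE// ler_norml; have /andP[] := wN t t01; lra.
  apply: lb_le_inf.
    by exists ((l *: C1w_one omega + w) a), a => //=; rewrite in_itv/= lexx ab.
  move=> _ [t /ab01 t01 <-]; rewrite wE//.
  (* What remains, c (l + N) <= l - N, is (1 + c) N <= (1 - c) l; it holds because 1 + c < 2. *)
  by have /andP[] := wN t t01; nra.
- have z01 : (0 : R) \in `[0, 1] by rewrite in_itv/= lexx ler01.
  apply: (@le_trans _ _ N).
    apply: weighted_norm_le => t t01.
    rewrite -[derive1 _ t]/(derive1 (l *: (one01 : R -> R) + (w : R -> R)) t).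
    rewrite derive1_linear.
    + by rewrite derive1_one01// mulr0 add0r; exact: C1w_norm_ge'.
    + by have [] := is_derive_one01 t t01.
    + exact: C1w_derivable.
  (* Any point of [0, 1] would do: the value at 0 is already at least l - N >= N. *)
  have := max_norm_ge (l *: C1w_one omega + w) z01.
  apply: le_trans; rewrite wE// ler_normr.
  by have /andP[] := wN 0 z01; lra.
Qed.

Theorem theorem2p2 (R : realType) (omega : weight R) (a b c : R)
    (a_ge0 : 0 <= a) (a_le_b : a <= b) (b_le1 : b <= 1)
    (c_gt0 : 0 < c) (c_lt1 : c < 1) :
  [set: C1w omega] =
  closure [set x - y | x in Kw omega a b c & y in Kw omega a b c].
Proof.
apply/seteqP; split => // w _; apply: subset_closure.
(* The least shift that [Kw_shift] admits for [w]. *)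
pose l := 2 * `|w| / (1 - c).
have lE : (1 - c) * l = 2 * `|w| by rewrite mulrC divfK// gt_eqF// subr_gt0.
exists (l *: C1w_one omega + w); first by apply: Kw_shift => //; rewrite lE.
exists (l *: C1w_one omega); last by rewrite addrAC subrr add0r.
(* The constant is the shift of the zero function by the same [l]. *)
rewrite -[l *: _]addr0; apply: Kw_shift => //.
by rewrite lE normr0 mulr0 mulr_ge0.
Qed.
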